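(* Let $\pi : E \to B$ be a diffeological bundle, let $e \in E$ and $b = \pi(e)$, and let $\iota : F \to E$ be the inclusion of the fiber $F = \pi^{-1}(b)$ over $b$ (with the sub-diffeology). If the pointed diffeological spaces $(E,e)$ and $(B,b)$ are filtered, then $\iota_* : T_e(F) \to T_e(E)$ is injective.
   Context: A diffeological space is a set $X$ with, for each $n \ge 0$ and each open $U \subseteq \mathbb{R}^n$, a specified set of functions $U \to X$ called plots, such that: every constant function $U\to X$ is a plot; if $U \to X$ is a plot and $V \to U$ is a smooth map between open subsets of Euclidean spaces, the composite $V \to X$ is a plot; and a function $U \to X$ whose restriction to each member of some open cover of $U$ is a plot is itself a plot. A function $f : X \to Y$ is smooth if $f \circ p$ is a plot of $Y$ for every plot $p$ of $X$; all maps between diffeological spaces are assumed smooth. Isomorphisms are called diffeomorphisms. A subset $A \subseteq X$ carries the sub-diffeology (plots are the functions $U \to A$ whose composite to $X$ is a plot); products and pullbacks carry the product diffeology and its sub-diffeology. A diffeological bundle with fiber $F$ is a smooth map $f : X \to Y$ such that for every plot $p : U \to Y$ the pullback $p^*(f)$ is locally trivial with fiber $F$, i.e. there is an open cover $U = \bigcup_i U_i$ such that the restriction of $p^*(f)$ to each $U_i$ is diffeomorphic, over $U_i$, to $U_i \times F$. A pointed plot $p : (U,0) \to (X,x)$ is a plot $p:U\to X$ where $U$ is a connected open neighbourhood of $0$ in some $\mathbb{R}^n$ and $p(0) = x$. The germ category $\mathcal{G}(X,x)$ has the pointed plots as objects; a morphism from $p : (U,0)\to (X,x)$ to $q : (V,0)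 \to (X,x)$ is the germ at $0$ of a smooth map $f : W \to V$, with $W$ an open neighbourhood of $0$ in $U$, $f(0)=0$ and $p|_W = q \circ f$. The internal tangent space $T_x(X)$ is the colimit, in real vector spaces, of the functor $\mathcal{G}(X,x) \to \mathrm{Vect}$ sending $p : (U,0) \to (X,x)$ to $T_0(U)$ and a germ $f$ to its derivative at $0$. The class of $u \in T_0(U)$ at $p$ is written $p_*(u)$. A smooth map $f : X \to Y$ induces a linear map $f_* : T_x(X) \to T_{f(x)}(Y)$ with $f_*(p_*(u)) = (f\circ p)_*(u)$. A category $\mathcal{C}$ is filtered if it is non-empty, any two objects $C, D$ admit morphisms $C \to E$ and $D \to E$ to a common object $E$, and for any parallel morphisms $f,g : C \to D$ there is a morphism $h : D \to E$ with $h\circ f = h \circ g$. A pointed diffeological space $(X,x)$ is filtered if the category $\mathcal{G}(X,x)$ is filtered. *)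

(* Defs.v *)
From HB Require Import structures.
From mathcomp Require Import all_boot all_order all_algebra.
From mathcomp Require Import all_classical all_reals all_analysis.

Set Implicit Arguments.
Unset Strict Implicit.
Unset Printing Implicit Defensive.

Import Order.TTheory GRing.Theory Num.Theory.
Import numFieldNormedType.Exports.

Local Open Scope classical_set_scope.
Local Open Scope quotient_scope.
Local Open Scope ring_scope.

Section NearDifferential.
Context {R : realType} {V W : normedModType R}.
Implicit Types f g : V -> W.

Lemma near_littleo_diff f g x : (\near x, f x = g x) -> differentiable f x ->
  g \o shift x = cst (g x) + 'd f x +o_ 0 id.
Proof.
move=> fg df; have fgx := nbhs_singleton fg.
apply/eqaddoP => e e0.
have /eqaddoP/(_ e e0) H := diff_locally df.
move: fg; rewrite (near_shift 0) /= => fg.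
near=> y.
have fgy : f (y + x) = g (y + x).
  by near: y; apply: filterS fg => z /=; rewrite subr0.
suff -> : (g \o shift x - (cst (g x) + 'd f x)) y =
    (f \o shift x - (cst (f x) + 'd f x)) y by near: y.
by rewrite !fctE /= -fgy -fgx.
Unshelve. all: by end_near. Qed.

Lemma near_eq_diff f g x : (\near x, f x = g x) -> differentiable f x ->
  'd g x = 'd f x :> (V -> W).
Proof.
move=> fg df; apply: diff_unique; first exact: diff_continuous.
exact: near_littleo_diff.
Qed.

Lemma near_eq_differentiable f g x :
  (\near x, f x = g x) -> differentiable f x -> differentiable g x.
Proof.
move=> fg df; apply/diff_locallyP; rewrite (near_eq_diff fg df); split.
  exact: diff_continuous.
exact: near_littleo_diff.
Qed.

End NearDifferential.

Section Ck.
Context {R : realType}.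

(* The usual C^k maps when [U] is an open subset of R^n: since the ['D_v f] are
   continuous as soon as [k] is positive, differentiability could be weakened
   to the existence of the partial derivatives.  The values of [f] outside of
   [U] are irrelevant. *)
Fixpoint Ck (k : nat) (V W : normedModType R) (U : set V) (f : V -> W) : Prop :=
  if k is k'.+1 then
    (forall x, U x -> differentiable f x) /\ forall v, Ck k' U ('D_v f)
  else forall x, U x -> {for x, continuous f}.

Lemma Ck_ext k (V W : normedModType R) (U : set V) (f g : V -> W) : open U ->
  (forall x, U x -> f x = g x) -> Ck k U f -> Ck k U g.
Proof.
move=> oU; elim: k f g => [|k IH] f g fg /=.
  move=> cf x Ux; have nfg : \near x, f x = g x.
    by apply: filterS (open_nbhs_nbhs (conj oU Ux)) => z; exact: fg.
  rewrite /prop_for /continuous_at -(fg x Ux).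
  exact: cvg_trans (near_eq_cvg nfg) (cf x Ux).
move=> [df Df]; have nfg x : U x -> \near x, f x = g x.
  by move=> Ux; apply: filterS (open_nbhs_nbhs (conj oU Ux)) => z; exact: fg.
split=> [x Ux|v]; first exact: near_eq_differentiable (nfg x Ux) (df x Ux).
by apply: IH (Df v) => x Ux; apply: near_eq_derive; exact: nfg.
Qed.

Lemma Ck_sub k (V W : normedModType R) (A U : set V) (f : V -> W) :
  A `<=` U -> Ck k U f -> Ck k A f.
Proof.
move=> AU; elim: k f => [|k IH] f /=; first by move=> H x /AU; exact: H.
by move=> [df Df]; split=> [x /AU|v]; [exact: df|exact: IH].
Qed.

Lemma Ck_local k (V W : normedModType R) (U : set V) (f : V -> W) :
  (forall x, U x -> exists A, A x /\ Ck k A f) -> Ck k U f.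
Proof.
elim: k f => [|k IH] f /= H; first by move=> x /H[A [Ax]]; exact.
split=> [x /H[A [Ax []]]|v]; first by move=> + _; exact.
by apply: IH => x /H[A [Ax [_ DA]]]; exists A.
Qed.

Lemma CkW k (V W : normedModType R) (U : set V) (f : V -> W) :
  Ck k.+1 U f -> Ck k U f.
Proof.
elim: k f => [|k IH] f [df Df].
  by move=> x /df/differentiable_continuous.
by split=> // v; apply: IH.
Qed.

Lemma Ck_cst k (V W : normedModType R) (U : set V) (a : W) :
  Ck k U (fun _ : V => a).
Proof.
elim: k a => [|k IH] a /=; first by move=> x _; exact: cvg_cst.
split=> [x _|v]; first exact: differentiable_cst.
by rewrite (_ : 'D_v _ = fun=> 0)//; apply/funext => x; exact: derive_cst.
Qed.

Lemma Ck_id k (V : normedModType R) (U : set V) : Ck k U (@id V).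
Proof.
case: k => [|k] /=; first by move=> x _; exact: cvg_id.
split=> [x _|v]; first exact: ex_diff.
rewrite (_ : 'D_v _ = fun=> v); first exact: Ck_cst.
by apply/funext => x; exact: derive_id.
Qed.

Lemma CkD k (V W : normedModType R) (U : set V) (f g : V -> W) : open U ->
  Ck k U f -> Ck k U g -> Ck k U (f + g).
Proof.
move=> oU; elim: k f g => [|k IH] f g /=.
  by move=> cf cg x Ux; apply: cvgD; [exact: cf|exact: cg].
move=> [df Df] [dg Dg]; split=> [x Ux|v].
  by apply: differentiableD; [exact: df|exact: dg].
apply: (@Ck_ext _ _ _ _ ('D_v f + 'D_v g)) => // [x Ux|]; last exact: IH.
by rewrite deriveD //; apply: diff_derivable; [exact: df|exact: dg].
Qed.

Lemma Ck_sum k (V W : normedModType R) (U : set V) n (f : 'I_n -> V -> W) :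
  open U -> (forall i, Ck k U (f i)) -> Ck k U (\sum_i f i).
Proof.
move=> oU H; elim/big_ind : _ => [|g h|i _]; last exact: H.
  exact: (Ck_cst k U (0 : W)).
exact: CkD.
Qed.

Lemma CkM k (V : normedModType R) (U : set V) (f g : V -> R) : open U ->
  Ck k U f -> Ck k U g -> Ck k U (f * g).
Proof.
move=> oU; elim: k f g => [|k IH] f g.
  by move=> cf cg x Ux; apply: (cvgM (cf x Ux) (cg x Ux)).
move=> cf cg; move: (cf) (cg) => [df Df] [dg Dg]; split=> [x Ux|v].
  by apply: differentiableM; [exact: df|exact: dg].
apply: (@Ck_ext _ _ _ _ (f * 'D_v g + g * 'D_v f)) => // [x Ux|].
  by rewrite deriveM//; apply: diff_derivable; [exact: (df x Ux)|exact: (dg x Ux)].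
by apply: CkD => //; apply: IH; [exact: CkW cf|exact: Dg|exact: CkW cg|exact: Df].
Qed.

Lemma diff_coord (V : normedModType R) m (f : V -> 'rV[R]_m) x i :
  differentiable f x -> differentiable (fun y => f y ord0 i : R) x.
Proof.
move=> df; exact: (differentiable_comp df (differentiable_coord (f x) ord0 i)).
Qed.

Lemma rV_sum_delta (V : normedModType R) m (f : V -> 'rV[R]_m) :
  f = \sum_i (fun y => f y ord0 i *: delta_mx ord0 i).
Proof.
by apply/funext => y; rewrite fct_sumE -row_sum_delta.
Qed.

Lemma Ck_coordP k (V : normedModType R) m (U : set V) (f : V -> 'rV[R]_m) :
  open U -> Ck k U f <-> forall i, Ck k U (fun y => f y ord0 i : R).
Proof.
move=> oU; elim: k f => [|k IH] f /=; split.
- move=> cf i x Ux.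
  exact: (continuous_comp (cf x Ux) (@coord_continuous _ _ _ ord0 i (f x))).
- move=> cf; rewrite [f]rV_sum_delta; apply: (@Ck_sum 0%N) => // i x Ux.
  by apply: cvgZl; exact: cf.
- move=> [df Df] i; split=> [x Ux|v]; first by apply: diff_coord; exact: df.
  have /IH/(_ i) := Df v; apply: Ck_ext => // x Ux.
  by rewrite derive_mx ?mxE//; apply: diff_derivable; exact: df.
- move=> H; have df x : U x -> differentiable f x.
    move=> Ux; rewrite [f]rV_sum_delta; apply: differentiable_sum => i.
    by apply: differentiableZl; have [+ _] := H i; exact.
  split=> // v; apply/IH => i.
  have [_ /(_ v)] := H i; apply: Ck_ext => // x Ux.
  by rewrite derive_mx ?mxE//; apply: diff_derivable; exact: df.
Qed.

Lemma Ck_comp k n m (W : normedModType R) (A : set 'rV[R]_n) (B : set 'rV[R]_m)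
    (f : 'rV[R]_n -> 'rV[R]_m) (g : 'rV[R]_m -> R) : open A ->
  (forall x, A x -> B (f x)) -> Ck k A f -> Ck k B g -> Ck k A (g \o f).
Proof.
move=> oA AB; elim: k g => [|k IH] g.
  by move=> cf cg x Ax; apply: continuous_comp; [exact: cf|exact/cg/AB].
move=> cf cg; move: (cf) (cg) => [df Df] [dg Dg]; split=> [x Ax|v].
  by apply: differentiable_comp; [exact: df|exact/dg/AB].
apply: (@Ck_ext _ _ _ _
    (\sum_i (fun y => 'D_v f y ord0 i) * ('D_(delta_mx ord0 i) g \o f))) => //.
  move=> x Ax; rewrite fct_sumE deriveE; last first.
    by apply: differentiable_comp; [exact: df|exact/dg/AB].
  rewrite diff_comp/=; [|exact: df|exact/dg/AB].
  rewrite -(deriveE v (df x Ax)).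
  rewrite [in RHS](row_sum_delta ('D_v f x)) linear_sum; apply: eq_bigr => i _.
  by rewrite linearZ /= -deriveE//; exact/dg/AB.
apply: Ck_sum => // i; apply: CkM => //; last first.
  by apply: IH => //; [exact: CkW cf|exact: Dg].
by apply/(Ck_coordP _ _ oA).1; exact: Df.
Qed.

End Ck.

Section Smooth.
Context {R : realType}.

Definition smooth_on n m (U : set 'rV[R]_n) (f : 'rV[R]_n -> 'rV[R]_m) : Prop :=
  forall k, Ck k U f.

(* The values of the extension [h] outside of [U] play no role. *)
Definition euclid_smooth n m (U : set 'rV[R]_n) (f : U -> 'rV[R]_m) : Prop :=
  exists2 h : 'rV[R]_n -> 'rV[R]_m, smooth_on U h & forall x : U, f x = h (val x).

Lemma smooth_on_comp n m l (A : set 'rV[R]_n) (B : set 'rV[R]_m)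
    (f : 'rV[R]_n -> 'rV[R]_m) (g : 'rV[R]_m -> 'rV[R]_l) :
  open A -> open B -> (forall x, A x -> B (f x)) ->
  smooth_on A f -> smooth_on B g -> smooth_on A (g \o f).
Proof.
move=> oA oB AB sf sg k; apply/(Ck_coordP k _ oA) => i.
by apply: (@Ck_comp _ _ _ _ R _ B f (fun y => g y ord0 i)) => //;
  apply/(Ck_coordP k _ oB).1.
Qed.

Lemma smooth_on_differentiable n m (U : set 'rV[R]_n) (f : 'rV[R]_n -> 'rV[R]_m) x :
  smooth_on U f -> U x -> differentiable f x.
Proof. by move=> /(_ 1%N)[+ _]; exact. Qed.

Definition open_cover n (U : set 'rV[R]_n) (C : set (set 'rV[R]_n)) : Prop :=
  (forall W, C W -> open W /\ W `<=` U) /\ U `<=` \bigcup_(W in C) W.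

End Smooth.

(* [plot] is stated for arbitrary subsets [U] of R^n, but [plot_open] leaves
   only the open ones. *)
HB.mixin Record isDiffeological (R : realType) X := {
  plot : forall n (U : set 'rV[R]_n), (U -> X) -> Prop;
  plot_open : forall n (U : set 'rV[R]_n) (p : U -> X), plot n U p -> open U;
  plot_cst : forall n (U : set 'rV[R]_n) (x : X), open U -> plot n U (fun=> x);
  plot_comp : forall n m (U : set 'rV[R]_n) (V : set 'rV[R]_m) (p : U -> X)
    (g : V -> U), plot n U p -> open V -> euclid_smooth (fun z => val (g z)) ->
    plot m V (p \o g);
  plot_local : forall n (U : set 'rV[R]_n) (p : U -> X) (C : set (set 'rV[R]_n)),
    open U -> open_cover U C ->
    (forall W (WU : W `<=` U), C W -> plot n W (p \o subfun WU)) -> plot n U p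
}.

#[short(type="diffeologicalType")]
HB.structure Definition Diffeological (R : realType) := {X of isDiffeological R X}.

Arguments plot {R s n U} p.
Arguments plot_open {R s n U p}.
Arguments plot_cst {R s n U} x.
Arguments plot_comp {R s n m U V} p g.
Arguments plot_local {R s n U} p C.

Section Diffeology.
Context {R : realType}.
Implicit Types X Y Z F : diffeologicalType R.

Definition smooth X Y (f : X -> Y) : Prop :=
  forall n (U : set 'rV[R]_n) (p : U -> X), plot p -> plot (f \o p).

Definition diffeomorphism X Y (f : X -> Y) : Prop :=
  smooth f /\ exists2 g : Y -> X, smooth g & cancel f g /\ cancel g f.

End Diffeology.

Section EuclideanDiffeology.
Context {R : realType} (d : nat).

Definition rV_plot n (U : set 'rV[R]_n) (p : U -> 'rV[R]_d) : Prop :=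
  open U /\ euclid_smooth p.

Fact rV_plot_open n (U : set 'rV[R]_n) (p : U -> 'rV[R]_d) :
  rV_plot p -> open U.
Proof. by case. Qed.

Fact rV_plot_cst n (U : set 'rV[R]_n) (x : 'rV[R]_d) :
  open U -> @rV_plot n U (fun=> x).
Proof. by move=> oU; split=> //; exists (fun=> x) => // k; exact: Ck_cst. Qed.

Fact rV_plot_comp n m (U : set 'rV[R]_n) (V : set 'rV[R]_m)
    (p : U -> 'rV[R]_d) (g : V -> U) :
  rV_plot p -> open V -> euclid_smooth (fun z => val (g z)) -> rV_plot (p \o g).
Proof.
move=> [oU [h sh ph]] oV [k sk gk]; split=> //; exists (h \o k).
  apply: (@smooth_on_comp _ _ _ _ _ U) => // x Vx.
  by rewrite -(gk (SigSub (mem_set Vx))); exact: set_valP.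
by move=> x /=; rewrite ph gk.
Qed.

Fact rV_plot_local n (U : set 'rV[R]_n) (p : U -> 'rV[R]_d)
    (C : set (set 'rV[R]_n)) :
  open U -> open_cover U C ->
  (forall W (WU : W `<=` U), C W -> rV_plot (p \o subfun WU)) -> rV_plot p.
Proof.
move=> oU [CU UC] H; split=> //.
pose h x := if insub x is Some u then p u else 0.
have hE (x : U) : h (val x) = p x by rewrite /h valK.
exists h => // k; apply: Ck_local => x /UC[W CW Wx]; exists W; split=> //.
have [oW WU] := CU _ CW; have [_ [g sg pg]] := H W WU CW.
apply: Ck_ext (sg k) => // z Wz.
by have := pg (SigSub (mem_set Wz)); rewrite /= -hE /= => ->.
Qed.

HB.instance Definition _ := isDiffeological.Build R 'rV[R]_d
  rV_plot_open rV_plot_cst rV_plot_comp rV_plot_local.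

End EuclideanDiffeology.

Section SubDiffeology.
Context {R : realType} {X : diffeologicalType R} (A : set X).

Definition sub_plot n (U : set 'rV[R]_n) (p : U -> A) : Prop :=
  plot (fun z => val (p z)).

Fact sub_plot_open n (U : set 'rV[R]_n) (p : U -> A) : sub_plot p -> open U.
Proof. exact: plot_open. Qed.

Fact sub_plot_cst n (U : set 'rV[R]_n) (x : A) :
  open U -> @sub_plot n U (fun=> x).
Proof. exact: plot_cst. Qed.

Fact sub_plot_comp n m (U : set 'rV[R]_n) (V : set 'rV[R]_m)
    (p : U -> A) (g : V -> U) :
  sub_plot p -> open V -> euclid_smooth (fun z => val (g z)) -> sub_plot (p \o g).
Proof. exact: plot_comp. Qed.

Fact sub_plot_local n (U : set 'rV[R]_n) (p : U -> A)
    (C : set (set 'rV[R]_n)) :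
  open U -> open_cover U C ->
  (forall W (WU : W `<=` U), C W -> sub_plot (p \o subfun WU)) -> sub_plot p.
Proof. exact: plot_local. Qed.

HB.instance Definition _ := isDiffeological.Build R (set_type A)
  sub_plot_open sub_plot_cst sub_plot_comp sub_plot_local.

Lemma smooth_val : @smooth R A X val.
Proof. by []. Qed.

End SubDiffeology.
Arguments smooth_val {R X} A.

Section ProductDiffeology.
Context {R : realType} {X Y : diffeologicalType R}.

Definition prod_plot n (U : set 'rV[R]_n) (p : U -> X * Y) : Prop :=
  plot (fst \o p) /\ plot (snd \o p).

Fact prod_plot_open n (U : set 'rV[R]_n) (p : U -> X * Y) :
  prod_plot p -> open U.
Proof. by case=> /plot_open. Qed.

Fact prod_plot_cst n (U : set 'rV[R]_n) (x : X * Y) :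
  open U -> @prod_plot n U (fun=> x).
Proof. by split; exact: plot_cst. Qed.

Fact prod_plot_comp n m (U : set 'rV[R]_n) (V : set 'rV[R]_m)
    (p : U -> X * Y) (g : V -> U) :
  prod_plot p -> open V -> euclid_smooth (fun z => val (g z)) ->
  prod_plot (p \o g).
Proof.
move=> [p1 p2] oV sg; split.
  exact: (plot_comp (fst \o p) g p1 oV sg).
exact: (plot_comp (snd \o p) g p2 oV sg).
Qed.

Fact prod_plot_local n (U : set 'rV[R]_n) (p : U -> X * Y)
    (C : set (set 'rV[R]_n)) :
  open U -> open_cover U C ->
  (forall W (WU : W `<=` U), C W -> prod_plot (p \o subfun WU)) -> prod_plot p.
Proof.
move=> oU UC H; split.
  apply: (plot_local (fst \o p) C oU UC) => W WU CW; exact: (H W WU CW).1.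
apply: (plot_local (snd \o p) C oU UC) => W WU CW; exact: (H W WU CW).2.
Qed.

HB.instance Definition _ := isDiffeological.Build R (X * Y)%type
  prod_plot_open prod_plot_cst prod_plot_comp prod_plot_local.

End ProductDiffeology.

Section Bundle.
Context {R : realType}.
Implicit Types X Y Z F : diffeologicalType R.

Definition pullback X Y Z (g : Z -> Y) (f : X -> Y) : set (Z * X) :=
  [set z | g z.1 = f z.2].

Definition locally_trivial F n (U : set 'rV[R]_n) Z (q : Z -> U) : Prop :=
  exists2 C, open_cover U C & forall W, C W ->
    exists2 phi : set_type (q @^-1` [set u : U | W (val u)]) -> (set_type W * F)%type,
      diffeomorphism phi & forall z, val (phi z).1 = val (q (val z)).

Definition bundle_with_fiber F X Y (f : X -> Y) : Prop :=
  smooth f /\ forall n (U : set 'rV[R]_n) (p : U -> Y), plot p ->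
    locally_trivial F (fun z : pullback p f => (val z).1).

Definition diffeological_bundle X Y (f : X -> Y) : Prop :=
  exists F, bundle_with_fiber F f.

Definition fiber X Y (f : X -> Y) (b : Y) : set X := f @^-1` [set b].

Definition fiber_point X Y (f : X -> Y) (x : X) : fiber f (f x) :=
  SigSub (mem_set (erefl : fiber f (f x) x)).

End Bundle.

Record category := Category {
  ob :> Type;
  mor : ob -> ob -> Type;
  idm : forall a, mor a a;
  compm : forall a b c, mor b c -> mor a b -> mor a c;
  comp1m : forall a b (f : mor a b), compm (idm b) f = f;
  compm1 : forall a b (f : mor a b), compm f (idm a) = f;
  compmA : forall a b c d (h : mor c d) (g : mor b c) (f : mor a b),
    compm h (compm g f) = compm (compm h g) f
}.

Definition filtered (C : category) : Prop :=
  [/\ inhabited C,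
      forall a b : C, exists c : C, inhabited (mor a c) /\ inhabited (mor b c) &
      forall (a b : C) (f g : mor a b),
        exists (c : C) (h : mor b c), compm h f = compm h g].

Record vect_functor (K : fieldType) (C : category) := VectFunctor {
  fob :> C -> lmodType K;
  fmap : forall a b, mor a b -> {linear fob a -> fob b};
  fmap1 : forall a, fmap (idm a) =1 id;
  fmap_comp : forall a b c (g : mor b c) (f : mor a b),
    fmap (compm g f) =1 fmap g \o fmap f
}.

Section Colimit.
Context {K : fieldType} {C : category} (D : vect_functor K C).

(* The colimit is the quotient of the direct sum of the [D c]: a sequence
   [:: (c1, u1); ...; (cn, un)] stands for u1 + ... + un. *)
Definition formal_sum : Type := {classic seq {c : C & D c}}.

Definition inj_sum (c : C) (u : D c) : formal_sum := [:: existT _ c u].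

Definition add_sum (s t : formal_sum) : formal_sum := s ++ t.

Definition scale_sum (k : K) (s : formal_sum) : formal_sum :=
  [seq existT (fun c : C => D c) (tag z) (k *: tagged z) | z <- s].

Inductive sum_eqv : formal_sum -> formal_sum -> Prop :=
| sum_eqv_refl s : sum_eqv s s
| sum_eqv_sym s t : sum_eqv s t -> sum_eqv t s
| sum_eqv_trans s t r : sum_eqv s t -> sum_eqv t r -> sum_eqv s r
| sum_eqv_add s s' t t' : sum_eqv s s' -> sum_eqv t t' ->
    sum_eqv (add_sum s t) (add_sum s' t')
| sum_eqv_addC s t : sum_eqv (add_sum s t) (add_sum t s)
| sum_eqv_inj0 c : sum_eqv (inj_sum (0 : D c)) [::]
| sum_eqv_injD c (u v : D c) :
    sum_eqv (inj_sum (u + v)) (add_sum (inj_sum u) (inj_sum v))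
| sum_eqv_fmap c d (f : mor c d) (u : D c) :
    sum_eqv (inj_sum u) (inj_sum (fmap D f u)).

Definition sum_eqvb (s t : formal_sum) : bool := `[< sum_eqv s t >].

Fact sum_eqvb_refl : reflexive sum_eqvb.
Proof. by move=> s; apply/asboolP; exact: sum_eqv_refl. Qed.

Fact sum_eqvb_sym : symmetric sum_eqvb.
Proof. by move=> s t; apply/asboolP/asboolP; exact: sum_eqv_sym. Qed.

Fact sum_eqvb_trans : transitive sum_eqvb.
Proof.
move=> t s r /asboolP st /asboolP tr; apply/asboolP; exact: sum_eqv_trans st tr.
Qed.

Canonical sum_equiv := EquivRel sum_eqvb sum_eqvb_refl sum_eqvb_sym sum_eqvb_trans.

Definition colim : Type := {eq_quot sum_equiv}.
HB.instance Definition _ := Choice.on colim.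
HB.instance Definition _ := EqQuotient.on colim.

Lemma colim_eqP (s t : formal_sum) :
  \pi_colim s = \pi_colim t <-> sum_eqv s t.
Proof. by split=> [/eqmodP/asboolP|st]; last exact/eqmodP/asboolP. Qed.

Lemma repr_colim (s : formal_sum) : sum_eqv (repr (\pi_colim s)) s.
Proof. by apply/colim_eqP; rewrite reprK. Qed.

Lemma scale_sum_eqv k s t : sum_eqv s t -> sum_eqv (scale_sum k s) (scale_sum k t).
Proof.
elim=> {s t} [s|s t _|s t r _ + _|s s' t t' _ + _|s t|c|c u v|c d f u].
- exact: sum_eqv_refl.
- exact: sum_eqv_sym.
- exact: sum_eqv_trans.
- by rewrite /scale_sum /add_sum !map_cat; exact: sum_eqv_add.
- by rewrite /scale_sum /add_sum !map_cat; exact: sum_eqv_addC.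
- by rewrite /scale_sum /= scaler0; exact: sum_eqv_inj0.
- by rewrite /scale_sum /= scalerDr; exact: sum_eqv_injD.
- by rewrite /scale_sum /= -linearZ; exact: sum_eqv_fmap.
Qed.

Definition colim_zero : colim := \pi_colim [::].
Definition colim_add (x y : colim) : colim := \pi_colim (add_sum (repr x) (repr y)).
Definition colim_scale k (x : colim) : colim := \pi_colim (scale_sum k (repr x)).
Definition colim_opp (x : colim) : colim := colim_scale (-1) x.

Lemma colim_addE s t :
  colim_add (\pi_colim s) (\pi_colim t) = \pi_colim (add_sum s t).
Proof. by apply/colim_eqP; apply: sum_eqv_add; exact: repr_colim. Qed.

Lemma colim_scaleE k s : colim_scale k (\pi_colim s) = \pi_colim (scale_sum k s).
Proof. by apply/colim_eqP/scale_sum_eqv; exact: repr_colim. Qed.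

Lemma colim_ind (P : colim -> Prop) : (forall s, P (\pi_colim s)) -> forall x, P x.
Proof. by move=> H x; rewrite -[x]reprK. Qed.

Fact colim_addA : associative colim_add.
Proof.
elim/colim_ind => s; elim/colim_ind => t; elim/colim_ind => r.
by rewrite !colim_addE /add_sum catA.
Qed.

Fact colim_addC : commutative colim_add.
Proof.
elim/colim_ind => s; elim/colim_ind => t.
by rewrite !colim_addE; apply/colim_eqP; exact: sum_eqv_addC.
Qed.

Fact colim_add0 : left_id colim_zero colim_add.
Proof. by elim/colim_ind => s; rewrite colim_addE. Qed.

Lemma scale_sumD k l s :
  sum_eqv (scale_sum (k + l) s) (add_sum (scale_sum k s) (scale_sum l s)).
Proof.
elim: s => [|[c u] s IH] /=; first exact: sum_eqv_refl.
apply: (@sum_eqv_trans _ (add_sum (add_sum (inj_sum (k *: u)) (inj_sum (l *: u)))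
    (add_sum (scale_sum k s) (scale_sum l s)))).
  rewrite -[_ :: _]/(add_sum (inj_sum ((k + l) *: u)) (scale_sum (k + l) s)).
  by apply: sum_eqv_add => //; rewrite scalerDl; exact: sum_eqv_injD.
have E : forall a b a' b' : formal_sum,
    sum_eqv (add_sum (add_sum a b) (add_sum a' b'))
            (add_sum (add_sum a a') (add_sum b b')).
  move=> a b a' b'; rewrite /add_sum -!catA.
  apply: sum_eqv_add; first exact: sum_eqv_refl.
  rewrite !catA; apply: sum_eqv_add; last exact: sum_eqv_refl.
  exact: sum_eqv_addC.
exact: E.
Qed.

Lemma scale_sum0 s : sum_eqv (scale_sum 0 s) [::].
Proof.
elim: s => [|[c u] s IH] /=; first exact: sum_eqv_refl.
rewrite scale0r -[_ :: _]/(add_sum (inj_sum (0 : D c)) (scale_sum 0 s)).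
exact: (sum_eqv_add (sum_eqv_inj0 c) IH).
Qed.

Lemma scale_sum1 s : scale_sum 1 s = s.
Proof. by elim: s => //= -[c u] s ->; rewrite scale1r. Qed.

Fact colim_addN : left_inverse colim_zero colim_opp colim_add.
Proof.
elim/colim_ind => s; rewrite /colim_opp colim_scaleE colim_addE.
rewrite -{2}[s]scale_sum1; apply/colim_eqP.
apply: sum_eqv_trans (sum_eqv_sym (scale_sumD _ _ _)) _.
by rewrite addNr; exact: scale_sum0.
Qed.

HB.instance Definition _ :=
  GRing.isZmodule.Build colim colim_addA colim_addC colim_add0 colim_addN.

Fact colim_scaleA k l x : colim_scale k (colim_scale l x) = colim_scale (k * l) x.
Proof.
elim/colim_ind: x => s; rewrite !colim_scaleE /scale_sum -map_comp.
by congr (\pi_colim _); apply: eq_map => -[c u] /=; rewrite scalerA.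
Qed.

Fact colim_scale1 : left_id 1 colim_scale.
Proof. by elim/colim_ind => s; rewrite colim_scaleE scale_sum1. Qed.

Fact colim_scaleDr : right_distributive colim_scale +%R.
Proof.
move=> k; elim/colim_ind => s; elim/colim_ind => t.
rewrite -[_ + _ in LHS]/(colim_add _ _) -[RHS]/(colim_add _ _).
by rewrite colim_addE !colim_scaleE colim_addE /scale_sum /add_sum map_cat.
Qed.

Fact colim_scaleDl v : {morph colim_scale^~ v : k l / k + l}.
Proof.
elim/colim_ind: v => s k l; rewrite -[RHS]/(colim_add _ _) !colim_scaleE colim_addE.
by apply/colim_eqP; exact: scale_sumD.
Qed.

HB.instance Definition _ := GRing.Zmodule_isLmodule.Build K colim
  colim_scaleA colim_scale1 colim_scaleDr colim_scaleDl.

Lemma pi_colimD s t : \pi_colim (add_sum s t) = \pi_colim s + \pi_colim t.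
Proof. by rewrite -colim_addE. Qed.

Lemma pi_colimZ k s : \pi_colim (scale_sum k s) = k *: \pi_colim s.
Proof. by rewrite -colim_scaleE. Qed.

Definition colim_in (c : C) (u : D c) : colim := \pi_colim (inj_sum u).

Fact colim_in_linear c : linear (@colim_in c).
Proof.
move=> k u v; rewrite -pi_colimZ -pi_colimD; apply/colim_eqP.
exact: sum_eqv_injD.
Qed.

HB.instance Definition _ c :=
  GRing.isLinear.Build K (D c) colim *:%R (@colim_in c) (@colim_in_linear c).

Lemma colim_in_fmap c d (f : mor c d) (u : D c) :
  colim_in (fmap D f u) = colim_in u.
Proof. by apply/esym/colim_eqP; exact: sum_eqv_fmap. Qed.

Record cocone (V : lmodType K) := Cocone {
  leg : forall c, {linear D c -> V};
  leg_fmap : forall c d (f : mor c d) (u : D c), leg d (fmap D f u) = leg c u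
}.

Section UniversalProperty.
Context {V : lmodType K} (t : cocone V).

Definition sum_desc (s : formal_sum) : V := \sum_(z <- s) leg t (tag z) (tagged z).

Lemma sum_desc_eqv s r : sum_eqv s r -> sum_desc s = sum_desc r.
Proof.
elim=> {s r} [//|//|s r q _ -> //|s s' r r' _ + _|s r|c|c u v|c d f u].
- by rewrite /sum_desc !big_cat /= => -> ->.
- by rewrite /sum_desc !big_cat /= addrC.
- by rewrite /sum_desc big_seq1 big_nil /= linear0.
- by rewrite /sum_desc !big_cons !big_nil /= !addr0 linearD.
- by rewrite /sum_desc !big_seq1 /= leg_fmap.
Qed.

Definition colim_desc (x : colim) : V := sum_desc (repr x).

Lemma colim_desc_pi s : colim_desc (\pi_colim s) = sum_desc s.
Proof. exact/sum_desc_eqv/repr_colim. Qed.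

Fact colim_desc_linear : linear colim_desc.
Proof.
move=> k; elim/colim_ind => s; elim/colim_ind => r.
rewrite -pi_colimZ -pi_colimD !colim_desc_pi /sum_desc big_cat /= big_map.
by rewrite scaler_sumr; congr (_ + _); apply: eq_bigr => z _; rewrite /= linearZ.
Qed.

HB.instance Definition _ :=
  GRing.isLinear.Build K colim V *:%R colim_desc colim_desc_linear.

Lemma colim_desc_in c (u : D c) : colim_desc (colim_in u) = leg t c u.
Proof. by rewrite colim_desc_pi /sum_desc big_seq1. Qed.

Lemma colim_desc_unique (h : {linear colim -> V}) :
  (forall c (u : D c), h (colim_in u) = leg t c u) -> h =1 colim_desc.
Proof.
move=> hE; elim/colim_ind => s; rewrite colim_desc_pi.
elim: s => [|[c u] s IH]; first by rewrite /sum_desc big_nil; exact: linear0.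
rewrite -[_ :: _]/(add_sum (inj_sum u) s) pi_colimD linearD IH.
by rewrite -/(colim_in u) hE /sum_desc big_cons.
Qed.

End UniversalProperty.

End Colimit.
Arguments colim_in {K C} D c u.

Section GermCategory.
Context {R : realType} {X : diffeologicalType R} (x : X).

Record pointed_plot := PointedPlot {
  pdim : nat;
  pdom : set 'rV[R]_pdim;
  pfun : pdom -> X;
  pfun_plot : plot pfun;
  pdom_connected : connected pdom;
  pdom0 : 0 \in pdom;
  pfun0 : pfun (SigSub pdom0) = x
}.

Arguments pdom : clear implicits.
Arguments pfun : clear implicits.
Arguments pdom_connected : clear implicits.
Implicit Types p q r : pointed_plot.

(* [f] represents a germ from [p] to [q]; its values outside of the
   neighbourhood [W] play no role. *)
Definition represents_germ p q (f : 'rV[R]_(pdim p) -> 'rV[R]_(pdim q)) : Prop :=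
  f 0 = 0 /\ exists W : set 'rV[R]_(pdim p),
    [/\ open_nbhs (0 : 'rV[R]_(pdim p)) W, W `<=` pdom p, smooth_on W f,
        forall z, W z -> pdom q (f z) &
        forall (z : pdom p) (w : pdom q),
          W (val z) -> val w = f (val z) -> pfun p z = pfun q w].

Record germ_rep p q := GermRep {
  grep :> 'rV[R]_(pdim p) -> 'rV[R]_(pdim q);
  grepP : represents_germ grep
}.

HB.instance Definition _ p q := gen_eqMixin (germ_rep p q).
HB.instance Definition _ p q := gen_choiceMixin (germ_rep p q).

Definition same_germ p q (f g : germ_rep p q) : bool :=
  `[< \forall z \near (0 : 'rV[R]_(pdim p)), f z = g z >].

Fact same_germ_refl p q : reflexive (@same_germ p q).
Proof. by move=> f; apply/asboolP; near=> z.
Unshelve. all: by end_near. Qed.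

Fact same_germ_sym p q : symmetric (@same_germ p q).
Proof. by move=> f g; apply/asboolP/asboolP; apply: filterS => z ->. Qed.

Fact same_germ_trans p q : transitive (@same_germ p q).
Proof.
move=> g f h /asboolP fg /asboolP gh; apply/asboolP.
by apply: filterS2 fg gh => z ->.
Qed.

Canonical germ_equiv p q := EquivRel (@same_germ p q)
  (@same_germ_refl p q) (@same_germ_sym p q) (@same_germ_trans p q).

Definition germ p q : Type := {eq_quot germ_equiv p q}.
HB.instance Definition _ p q := Choice.on (germ p q).
HB.instance Definition _ p q := EqQuotient.on (germ p q).

Definition germ_of p q (f : germ_rep p q) : germ p q := \pi f.

Lemma germ_eqP p q (f g : germ_rep p q) :
  germ_of f = germ_of g <-> \forall z \near (0 : 'rV[R]_(pdim p)), f z = g z.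
Proof. by split=> [/eqmodP/asboolP|fg]; last exact/eqmodP/asboolP. Qed.

Lemma repr_germ p q (f : germ_rep p q) :
  \forall z \near (0 : 'rV[R]_(pdim p)), repr (germ_of f) z = f z.
Proof. by apply/germ_eqP; rewrite /germ_of reprK. Qed.

Lemma germ_ind p q (P : germ p q -> Prop) :
  (forall f, P (germ_of f)) -> forall g, P g.
Proof. by move=> H g; rewrite -[g]reprK; exact: H. Qed.

Lemma grep0 p q (f : germ_rep p q) : f 0 = 0.
Proof. by case: (grepP f). Qed.

Lemma grep_differentiable p q (f : germ_rep p q) : differentiable f 0.
Proof.
have [_ [W [[_ W0] _ sW _ _]]] := grepP f.
exact: smooth_on_differentiable sW W0.
Qed.

Lemma grep_cvg p q (f : germ_rep p q) :
  f z @[z --> (0 : 'rV[R]_(pdim p))] --> (0 : 'rV[R]_(pdim q)).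
Proof.
by have /differentiable_continuous := grep_differentiable f;
  rewrite /prop_for /continuous_at grep0.
Qed.

Fact represents_germ_id p : represents_germ (id : 'rV[R]_(pdim p) -> 'rV[R]_(pdim p)).
Proof.
split=> //; exists (pdom p); split=> //.
- by split; [exact: (plot_open (pfun_plot p))|exact/set_mem/pdom0].
- by move=> k; exact: Ck_id.
- by move=> z w _ /val_inj ->.
Qed.

Fact represents_germ_comp p q r (g : germ_rep q r) (f : germ_rep p q) :
  @represents_germ p r (g \o f).
Proof.
have [f0 [W [[oW W0] WU sf Wf pf]]] := grepP f.
have [g0 [W' [[oW' W'0] WU' sg Wg pg]]] := grepP g.
split=> [/=|]; first by rewrite f0 g0.
have oA : open (W `&` f @^-1` W').
  rewrite openE => z [Wz Wfz]; apply: filterI.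
    exact: open_nbhs_nbhs (conj oW Wz).
  have /differentiable_continuous := smooth_on_differentiable sf Wz.
  by apply; exact: open_nbhs_nbhs (conj oW' Wfz).
exists (W `&` f @^-1` W'); split.
- by split=> //; split=> //=; rewrite f0.
- by move=> z [/WU].
- apply: (@smooth_on_comp _ _ _ _ _ W') => // [z []//|k].
  by apply: Ck_sub (sf k) => z [].
- by move=> z [_ /Wg].
- move=> z w [Wz W'z] wE.
  have qfz : f (val z) \in pdom q by apply/mem_set/Wf.
  by rewrite (pf z (SigSub qfz)) //; exact: pg.
Qed.

Definition germ_id p : germ p p := germ_of (GermRep (represents_germ_id p)).

Definition germ_comp p q r (g : germ q r) (f : germ p q) : germ p r :=
  germ_of (GermRep (represents_germ_comp (repr g) (repr f))).

Lemma germ_compE p q r (g : germ_rep q r) (f : germ_rep p q) :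
  germ_comp (germ_of g) (germ_of f) = germ_of (GermRep (represents_germ_comp g f)).
Proof.
apply/germ_eqP => /=.
have H : \forall z \near (0 : 'rV[R]_(pdim p)), repr (germ_of g) (f z) = g (f z).
  exact: (grep_cvg f (repr_germ g)).
by apply: filterS2 (repr_germ f) H => z ->.
Qed.

Fact germ_comp1m p q (f : germ p q) : germ_comp (germ_id q) f = f.
Proof. by elim/germ_ind: f => f; rewrite germ_compE; apply/germ_eqP; near=> z.
Unshelve. all: by end_near. Qed.

Fact germ_compm1 p q (f : germ p q) : germ_comp f (germ_id p) = f.
Proof. by elim/germ_ind: f => f; rewrite germ_compE; apply/germ_eqP; near=> z.
Unshelve. all: by end_near. Qed.

Fact germ_compA p q r s (h : germ r s) (g : germ q r) (f : germ p q) :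
  germ_comp h (germ_comp g f) = germ_comp (germ_comp h g) f.
Proof.
elim/germ_ind: h => h; elim/germ_ind: g => g; elim/germ_ind: f => f.
by rewrite !germ_compE; apply/germ_eqP; near=> z.
Unshelve. all: by end_near. 
Qed.

Definition germ_category : category :=
  Category germ_comp1m germ_compm1 germ_compA.

Definition germ_diff p q (f : germ p q) : {linear 'rV[R]_(pdim p) -> 'rV[R]_(pdim q)} :=
  'd (repr f) 0.

Lemma germ_diffE p q (f : germ_rep p q) : germ_diff (germ_of f) =1 'd f 0.
Proof.
have H : \forall z \near (0 : 'rV[R]_(pdim p)), f z = repr (germ_of f) z.
  by apply: filterS (repr_germ f) => z ->.
by move=> u; exact: (congr1 (@^~ u) (near_eq_diff H (grep_differentiable f))).
Qed.

Fact germ_diff1 p : germ_diff (germ_id p) =1 id.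
Proof. by move=> u; rewrite germ_diffE diff_val. Qed.

Fact germ_diff_comp p q r (g : germ q r) (f : germ p q) :
  germ_diff (germ_comp g f) =1 germ_diff g \o germ_diff f.
Proof.
move=> u; rewrite germ_diffE /= diff_comp /=; last 2 first.
- exact: grep_differentiable.
- by rewrite grep0; exact: grep_differentiable.
by rewrite grep0.
Qed.

(* T_0(U) is identified with R^n for an open U in R^n. *)
Definition germ_tangent : vect_functor R germ_category :=
  @VectFunctor R germ_category (fun p => 'rV[R]_(pdim p) : lmodType R)
    germ_diff germ_diff1 germ_diff_comp.

Definition internal_tangent : lmodType R := colim germ_tangent.

Definition tangent_class p : {linear 'rV[R]_(pdim p) -> internal_tangent} :=
  colim_in germ_tangent p : {linear germ_tangent p -> colim germ_tangent}.

Definition filtered_pointed : Prop := filtered germ_category.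

End GermCategory.
Arguments pdom {R X x} p.
Arguments pfun {R X x} p.
Arguments pdom_connected {R X x} p.

Section TangentMap.
Context {R : realType} {X Y : diffeologicalType R} (f : X -> Y) (sf : smooth f) (x : X).

Fact push_plot0 (p : pointed_plot x) : (f \o pfun p) (SigSub (pdom0 p)) = f x.
Proof. by rewrite /= pfun0. Qed.

Definition push_plot (p : pointed_plot x) : pointed_plot (f x) :=
  PointedPlot (sf (pfun_plot p)) (pdom_connected p) (push_plot0 p).

Fact represents_germ_push (p q : pointed_plot x) (g : germ_rep p q) :
  @represents_germ _ _ _ (push_plot p) (push_plot q) g.
Proof.
have [g0 [W [oW WU sg Wg pg]]] := grepP g.
by split=> //; exists W; split=> // z w Wz zw /=; rewrite (pg z w).
Qed.

Fact push_class_fmap (p q : pointed_plot x) (g : germ p q) (u : 'rV[R]_(pdim p)) :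
  tangent_class (push_plot q) (germ_diff g u) = tangent_class (push_plot p) u.
Proof.
move: g; apply: germ_ind => g; rewrite germ_diffE.
have E := germ_diffE (GermRep (represents_germ_push g)) u.
have F := @colim_in_fmap _ _ (germ_tangent (f x)) _ _
  (germ_of (GermRep (represents_germ_push g))) u.
exact: (etrans (congr1 (tangent_class (push_plot q)) (esym E)) F).
Qed.

Definition push_cocone : cocone (germ_tangent x) (internal_tangent (f x)) :=
  @Cocone _ _ (germ_tangent x) _ (fun p => tangent_class (push_plot p)) push_class_fmap.

Definition tangent_map : {linear internal_tangent x -> internal_tangent (f x)} :=
  colim_desc push_cocone.

Lemma tangent_map_class (p : pointed_plot x) (u : 'rV[R]_(pdim p)) :
  tangent_map (tangent_class p u) = tangent_class (push_plot p) u.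
Proof. exact: (@colim_desc_in _ _ (germ_tangent x) _ push_cocone p u). Qed.

End TangentMap.

(* Main.v *)
Require Import Defs.
From HB Require Import structures.
From mathcomp Require Import all_boot all_order all_algebra.
From mathcomp Require Import all_classical all_reals all_analysis.
Import Defs.

(** A filtered colimit of vector spaces has no elements beyond the classes of
    single vectors, and such a class vanishes only if some morphism kills the
    vector ([colim_in_surj], [colim_in_eq0]).  So, when E is filtered at e, a
    class p_*(u) of T_e(F) that dies in T_e(E) is killed by the derivative of
    a germ g : p -> q, where q : V -> E is a plot that need not stay in F.  The
    point is to replace q by a plot k of the fiber through which p still
    factors by the same g; then p_*(u) = k_*(g_*(u)) = 0 already in T_e(F).

    To find k, observe that f o q o g is the constant b = f(e), so g and 0 are
    parallel morphisms from a constant plot to f o q in the germ category of B.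
    As B is filtered at b, some h : f o q -> r satisfies h o g = h o 0 = 0.  The
    bundle pulled back along r is a product near 0, hence q lifts to it as
    v |-> (h(v), c(v)) with c(v) in the typical fiber; setting the base
    coordinate to 0 gives the plot k(v) = (0, c(v)) of F, and k agrees with q
    where h vanishes, in particular k o g = q o g = p ([vertical_plot],
    [vertical_germ]).

    Nothing says beforehand that F is filtered at e, so an element of T_e(F) is
    at first a sum of classes of several plots.  The same construction, applied
    to a plot q of E above two plots of F, yields a plot of F above both
    ([fiber_plot_ub]), and that is enough to make every element of T_e(F) the
    class of a single vector ([fiber_class_surj]). *)

Set Implicit Arguments.
Unset Strict Implicit.
Unset Printing Implicit Defensive.

Import Order.TTheory GRing.Theory Num.Theory.
Import numFieldNormedType.Exports.

Local Open Scope classical_set_scope.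
Local Open Scope quotient_scope.
Local Open Scope ring_scope.

(** * Filtered colimits of vector spaces *)

Section FilteredColimit.
Context {K : fieldType} {C : category} (D : vect_functor K C).

Lemma filtered_coequalize2 (a1 a2 b : C) (f1 g1 : mor a1 b) (f2 g2 : mor a2 b) :
  filtered C -> exists (c : C) (h : mor b c),
    compm h f1 = compm h g1 /\ compm h f2 = compm h g2.
Proof.
move=> [_ _ coeq]; have [c [h1 E1]] := coeq _ _ f1 g1.
have [d [h2 E2]] := coeq _ _ (compm h1 f2) (compm h1 g2).
by exists d, (compm h2 h1); rewrite -!compmA E1 E2.
Qed.

(** Only upper bounds of pairs of objects are assumed: this is what is known of
    the germ category of the fiber. *)
Lemma colim_in_surj :
  inhabited C ->
  (forall a b : C, exists c : C, inhabited (mor a c) /\ inhabited (mor b c)) ->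
  forall x : colim D, exists (c : C) (u : D c), x = colim_in D c u.
Proof.
move=> [c0] ub; elim/(@colim_ind K C D); elim=> [|[a u] s [b [v sE]]].
  by exists c0, 0; rewrite linear0.
have [c [[i] [j]]] := ub a b; exists c, (fmap D i u + fmap D j v).
rewrite linearD /= !colim_in_fmap -sE.
by rewrite -[_ :: _]/(add_sum (inj_sum u) s) pi_colimD.
Qed.

(** The possible values at [d] of a formal sum, one for each choice of morphisms
    from its indices to [d].  Two formal sums represent the same element of a
    filtered colimit if and only if they have a common value somewhere; taking
    this as the description of equality is what makes [colim_in_eq0] provable
    by induction on [sum_eqv]. *)
Fixpoint eval_sum (d : C) (s : seq {c : C & D c}) (v : D d) : Prop :=
  if s is z :: s' then
    exists (g : mor (tag z) d) (w : D d),
      v = fmap D g (tagged z) + w /\ eval_sum s' w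
  else v = 0.

Lemma eval_sum_fmap d d' (h : mor d d') s (v : D d) :
  eval_sum s v -> eval_sum s (fmap D h v).
Proof.
elim: s v => [|[c u] s IH] v /=; first by move=> ->; rewrite linear0.
move=> [g [w [-> sw]]]; exists (compm h g), (fmap D h w).
by rewrite linearD fmap_comp; split=> //; exact: IH.
Qed.

Lemma eval_sum1 c d (u : D c) (g : mor c d) :
  eval_sum (inj_sum u) (fmap D g u).
Proof. by exists g, 0; rewrite addr0. Qed.

Lemma eval_sum_catP d s t (v : D d) : eval_sum (s ++ t) v <->
  exists a b, [/\ v = a + b, eval_sum s a & eval_sum t b].
Proof.
elim: s v => [|[c u] s IH] v /=.
  by split=> [tv|[_ [b [-> -> tb]]]]; [exists 0, v; rewrite add0r|rewrite add0r].
split=> [[g [w [-> /IH[a [b [-> sa tb]]]]]]|[_ [b [-> [g [w [-> sw]]] tb]]]].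
  by exists (fmap D g u + a), b; rewrite addrA; split=> //; exists g, a.
by exists g, (w + b); rewrite addrA; split=> //; apply/IH; exists w, b.
Qed.

Hypothesis filC : filtered C.

(** Two values of one sum differ only by choices of morphisms, which can be
    coequalized one term at a time.  This yields transitivity of the relation
    of having a common value. *)
Lemma eval_sum_confluent d d' s (v : D d) (w : D d') :
  eval_sum s v -> eval_sum s w ->
  exists (c : C) (h : mor d c) (h' : mor d' c), fmap D h v = fmap D h' w.
Proof.
have [_ ub coeq] := filC.
elim: s v w => [|[a u] s IH] v w /=.
  move=> -> ->; have [c [[i] [j]]] := ub d d'.
  by exists c, i, j; rewrite !linear0.
move=> [g [v' [-> sv']]] [g' [w' [-> sw']]].
have [b [h [h' E]]] := IH _ _ sv' sw'.
have [c [k kE]] := coeq _ _ (compm h g) (compm h' g').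
exists c, (compm k h), (compm k h').
rewrite !linearD; congr (_ + _); last by rewrite !fmap_comp /= E.
by rewrite -[LHS]fmap_comp -[RHS]fmap_comp -!compmA kE.
Qed.

Lemma eval_sum_total s : exists (d : C) (v : D d), eval_sum s v.
Proof.
have [[c0] ub _] := filC.
elim: s => [|[c u] s [d [v sv]]]; first by exists c0, 0.
have [b [[i] [j]]] := ub c d; exists b, (fmap D i u + fmap D j v), i, (fmap D j v).
by split=> //; exact: eval_sum_fmap.
Qed.

Lemma eval_sum_eqv s t : sum_eqv s t ->
  exists (d : C) (v : D d), eval_sum s v /\ eval_sum t v.
Proof.
have [_ ub _] := filC.
elim=> {s t} [s|s t _ [d [v [sv tv]]]|s t r _ [d [v [sv tv]]] _ [d' [w [tw rw]]]|
  s s' t t' _ [d [v [sv s'v]]] _ [d' [w [tw t'w]]]|s t|c|c u v|c d g u].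
- by have [d [v sv]] := eval_sum_total s; exists d, v.
- by exists d, v.
- have [c [h [h' E]]] := eval_sum_confluent tv tw.
  exists c, (fmap D h v); split; first exact: eval_sum_fmap.
  by rewrite E; exact: eval_sum_fmap.
- have [c [[i] [j]]] := ub d d'.
  exists c, (fmap D i v + fmap D j w); split; apply/eval_sum_catP;
    by exists (fmap D i v), (fmap D j w); split=> //; exact: eval_sum_fmap.
- have [d [v /[dup] stv /eval_sum_catP[a [b [vab sa tb]]]]] :=
    eval_sum_total (s ++ t).
  exists d, v; split=> //; apply/eval_sum_catP; exists b, a.
  by rewrite addrC.
- exists c, 0; split=> //.
  by rewrite -[X in eval_sum _ X](linear0 (fmap D (idm c))); exact: eval_sum1.
- exists c, (fmap D (idm c) (u + v)); split; first exact: eval_sum1.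
  rewrite linearD; apply/eval_sum_catP.
  by exists (fmap D (idm c) u), (fmap D (idm c) v); split=> //; exact: eval_sum1.
- exists d, (fmap D (compm (idm d) g) u); split; first exact: eval_sum1.
  by rewrite fmap_comp; exact: eval_sum1.
Qed.

Lemma colim_in_eq0 (c : C) (u : D c) : colim_in D c u = 0 ->
  exists (d : C) (g : mor c d), fmap D g u = 0.
Proof.
move=> /colim_eqP/eval_sum_eqv[d [v /= [[g [w [vE w0]]] v0]]].
by exists d, g; rewrite -[RHS]v0 vE w0 addr0.
Qed.

End FilteredColimit.

(** * Moving a plot of the total space into a fiber *)

Section Fiber.
Context {R : realType}.

(** The ball is a union of segments that start at its center. *)
Lemma ball_connected (V : normedModType R) (x : V) (r : R) : connected (ball x r).
Proof.
have -> : ball x r = \bigcup_(y in ball x r)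
    ((fun t : R => x + t *: (y - x)) @` `[0, 1]%classic).
  apply/seteqP; split=> [y xy|z [y xy [t]]].
    by exists y => //; exists 1; rewrite /= ?in_itv /= ?lexx ?ler01 ?scale1r ?subrKC.
  rewrite /= in_itv /= => /andP[t0 t1] <-.
  move: xy; rewrite -ball_normE /= opprD addNKr normrN normrZ ger0_norm//.
  by rewrite distrC; apply: le_lt_trans; exact: ler_piMl.
have [r0|r0] := ltP 0 r; last first.
  rewrite (_ : ball x r = set0) ?bigcup_set0; first exact: connected0.
  apply/seteqP; split=> // y; rewrite -ball_normE /=.
  by move=> /(le_lt_trans (normr_ge0 _)); rewrite ltNge r0.
apply: bigcup_connected.
  exists x => y _ /=; exists 0; rewrite /= ?in_itv /= ?lexx ?ler01//.
  by rewrite scale0r addr0.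
move=> y _; apply: connected_continuous_connected; first exact: segment_connected.
apply: continuous_subspaceT => t; apply: cvgD; first exact: cvg_cst.
by apply: cvgZr_tmp; exact: cvg_id.
Qed.

(** Around 0, [k] is [q] with its base coordinate moved to 0 in a local
    trivialization of the pullback of [f] along [r].  The map [h] enters because
    it lifts [q] to that pullback. *)
Lemma vertical_plot (E B : diffeologicalType R) (f : E -> B) (sf : smooth f)
    (e : E) (q : pointed_plot e) (r : pointed_plot (f e))
    (h : germ_rep (push_plot sf q) r) :
  diffeological_bundle f ->
  exists (V : set 'rV[R]_(pdim q)) (k : V -> fiber f (f e)),
    [/\ plot k, connected V, V 0 &
        forall (v : V) (w : pdom q), val v = val w -> h (val v) = 0 ->
          val (k v) = pfun q w].
Proof.
move=> [F [_ /(_ _ _ _ (pfun_plot r))[C [Copen Ccov] Ctriv]]].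
have [h0 [N [[oN N0] /= NU sh hN fh]]] := grepP h.
have [W CW W0] := Ccov 0 (set_mem (pdom0 r)).
have [oW WU] := Copen W CW.
have [phi [sphi [psi spsi [phiK psiK]]] phiE] := Ctriv W CW.
have : nbhs (0 : 'rV[R]_(pdim q)) (N `&` h @^-1` W).
  apply: filterI; first exact: open_nbhs_nbhs.
  by apply: (grep_cvg h); exact: open_nbhs_nbhs.
move=> /nbhs_ballP[eps /= eps0 VN]; set V : set 'rV[R]_(pdim q) := ball 0 eps in VN.
have V0 : V 0 by exact: ballxx.
have oV : open V by exact: ball_open.
have hU (v : V) : h (val v) \in pdom r by apply/mem_set/hN; case: (VN _ (set_valP v)).
have qU (v : V) : val v \in pdom q by apply/mem_set/NU; case: (VN _ (set_valP v)).
have pbP (v : V) : (SigSub (hU v), pfun q (SigSub (qU v))) \in pullback (pfun r) f.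
  by apply/mem_set => /=; apply/esym/fh => //=; case: (VN _ (set_valP v)).
pose Z : set (pullback (pfun r) f) :=
  (fun z : pullback (pfun r) f => (val z).1) @^-1` [set u | W (val u)].
have ZP (v : V) : SigSub (pbP v) \in Z.
  by apply/mem_set; rewrite /Z /=; case: (VN _ (set_valP v)).
pose lift (v : V) : Z := SigSub (ZP v).
have lift_plot : plot lift.
  split.
    by split=> //; exists h => // i; apply: Ck_sub (sh i) => z /VN[].
  apply: (plot_comp (pfun q) (fun v => SigSub (qU v)) (pfun_plot q) oV).
  by exists id => // i; exact: Ck_id.
(* Replacing the base coordinate of [phi (lift v)] by 0. *)
pose z0 : W := SigSub (mem_set W0).
pose k (v : V) : Z := psi (z0, (phi (lift v)).2).
have k_plot : plot k.
  apply: spsi; split; first exact: plot_cst.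
  exact: (sphi _ _ _ lift_plot).2.
have kZ (v : V) : val (val (val (k v))).1 = 0 by rewrite -phiE psiK.
have kF (v : V) : (val (val (k v))).2 \in fiber f (f e).
  apply/mem_set; rewrite /fiber /=.
  rewrite -(set_valP (val (k v))) /=; apply: etrans (pfun0 r).
  by congr (pfun r _); exact/val_inj/kZ.
exists V, (fun v => SigSub (kF v)); split=> //.
- exact: k_plot.2.
- exact: ball_connected.
move=> v w vw hv0 /=.
rewrite /k; have -> : (z0, (phi (lift v)).2) = phi (lift v).
  rewrite [RHS]surjective_pairing; congr (_, _); apply/val_inj.
  by rewrite phiE /= hv0.
by rewrite phiK /=; congr (pfun q _); exact/val_inj.
Qed.

Context {E B : diffeologicalType R} (f : E -> B) (sf : smooth f) (e : E).
Hypothesis bf : diffeological_bundle f.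

Local Notation F := (fiber f (f e)).
Local Notation e' := (fiber_point f e).
Local Notation incl := (push_plot (smooth_val F) (x := e')).

(** The plot of the fiber is given by its components rather than as a
    [pointed_plot], so that its dimension is that of [q] by definition and [g]
    itself can represent a germ into it. *)
Lemma vertical_germ (q : pointed_plot e) (r : pointed_plot (f e))
    (h : germ_rep (push_plot sf q) r) :
  exists (V : set 'rV[R]_(pdim q)) (k : V -> F) (kp : plot k) (Vc : connected V)
      (V0 : 0 \in V) (k0 : k (SigSub V0) = e'),
    forall (p : pointed_plot e') (g : germ_rep (incl p) q),
      (\forall z \near (0 : 'rV[R]_(pdim p)), h (g z) = 0) ->
      represents_germ (p := p) (q := PointedPlot kp Vc k0) g.
Proof.
have [V [k [kp Vc V0 kE]]] := vertical_plot h bf.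
have k0 : k (SigSub (mem_set V0)) = e'.
  apply/val_inj => /=; rewrite (kE _ (SigSub (pdom0 q))) //; first exact: pfun0.
  exact: (grep0 h).
exists V, k, kp, Vc, (mem_set V0), k0 => p g hg0.
have [g0 [N [[oN N0] NU sg gN pg]]] := grepP g.
have : nbhs (0 : 'rV[R]_(pdim p))
    (N `&` (g @^-1` V `&` [set z | h (g z) = 0])).
  apply: filterI; first exact: open_nbhs_nbhs.
  apply: filterI => //; apply: (grep_cvg g).
  exact: open_nbhs_nbhs (conj (plot_open kp) V0).
rewrite nbhsE => -[M oM MN].
split=> //; exists M; split=> //.
- by move=> z /MN[/NU].
- by move=> i; apply: Ck_sub (sg i) => z /MN[].
- by move=> z /MN[_ []].
- move=> z w Mz wE; have [Nz [/= _ hz]] := MN _ Mz.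
  apply/val_inj; rewrite /= (kE w (SigSub (mem_set (gN _ Nz)))) ?wE//.
  exact: pg.
Qed.

(** The projection of a plot of the fiber is constant, so the zero map is also a
    germ into the projection of [q]. *)
Lemma represents_germ_cst0 (p : pointed_plot e') (q : pointed_plot e) :
  @represents_germ R B (f e) (push_plot sf (incl p)) (push_plot sf q) (fun=> 0).
Proof.
split=> //; exists (pdom p); split=> //.
- by split; [exact: (plot_open (pfun_plot p))|exact/set_mem/pdom0].
- by move=> i; exact: Ck_cst.
- by move=> z _; exact/set_mem/pdom0.
- move=> z w _ wE; rewrite /= (set_valP (pfun p z)) -[in LHS](pfun0 q).
  by congr (f (pfun q _)); exact/val_inj.
Qed.

(** * The internal tangent space of a fiber *)

Hypothesis filB : filtered_pointed (f e).

(** Filteredness of the base provides the germ [h] required by [vertical_germ],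
    by coequalizing the projections of [g1] and [g2] with zero maps. *)
Lemma common_vertical_germ (q : pointed_plot e) (p1 p2 : pointed_plot e')
    (g1 : germ_rep (incl p1) q) (g2 : germ_rep (incl p2) q) :
  exists (V : set 'rV[R]_(pdim q)) (k : V -> F) (kp : plot k) (Vc : connected V)
      (V0 : 0 \in V) (k0 : k (SigSub V0) = e'),
    represents_germ (p := p1) (q := PointedPlot kp Vc k0) g1 /\
    represents_germ (p := p2) (q := PointedPlot kp Vc k0) g2.
Proof.
pose fg (p : pointed_plot e') (g : germ_rep (incl p) q) :=
  germ_of (GermRep (represents_germ_push sf g)).
pose cst0 p := germ_of (GermRep (represents_germ_cst0 p q)).
have [r [h [E1 E2]]] := @filtered_coequalize2 (germ_category (f e)) _ _ _
  (fg _ g1) (cst0 p1) (fg _ g2) (cst0 p2) filB.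
move: h E1 E2; apply: germ_ind => h E1 E2.
have h0 (p : pointed_plot e') (g : germ_rep (incl p) q) :
    germ_comp (germ_of h) (fg _ g) = germ_comp (germ_of h) (cst0 p) ->
    \forall z \near (0 : 'rV[R]_(pdim p)), h (g z) = 0.
  rewrite !germ_compE => /germ_eqP; apply: filterS => z /= ->.
  exact: (grep0 h).
have [V [k [kp [Vc [V0 [k0 kP]]]]]] := vertical_germ h.
exists V, k, kp, Vc, V0, k0; split; apply: kP; exact: h0.
Qed.

Hypothesis filE : filtered_pointed e.

(** The plots [p1] and [p2] factor through a plot of the total space, which is
    then moved into the fiber. *)
Lemma fiber_plot_ub (p1 p2 : pointed_plot e') :
  exists k : pointed_plot e', inhabited (germ p1 k) /\ inhabited (germ p2 k).
Proof.
have [_ ub _] := filE.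
have [q [[g1] [g2]]] := ub (incl p1) (incl p2).
move: g1 g2; apply: germ_ind => g1; apply: germ_ind => g2.
have [V [k [kp [Vc [V0 [k0 [G1 G2]]]]]]] := common_vertical_germ g1 g2.
exists (PointedPlot kp Vc k0).
by split; constructor; apply: germ_of; [exact: GermRep G1|exact: GermRep G2].
Qed.

Lemma fiber_class_surj (xi : internal_tangent e') :
  exists p u, xi = tangent_class p u.
Proof.
apply: (@colim_in_surj _ (germ_category e') (germ_tangent e')).
  have [[q] _ _] := filE; constructor.
  exact: (@PointedPlot R F e' _ _ (fun=> e')
    (plot_cst e' (plot_open (pfun_plot q))) (pdom_connected q) (pdom0 q) erefl).
exact: fiber_plot_ub.
Qed.

(** The germ that kills [u] in the total space also represents a germ between
    plots of the fiber, with the same derivative. *)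
Lemma fiber_class_eq0 (p : pointed_plot e') u :
  tangent_class (incl p) u = 0 -> tangent_class p u = 0.
Proof.
move=> /(@colim_in_eq0 _ (germ_category e) (germ_tangent e) filE).
move=> [q [g]]; move: g; apply: germ_ind => g gu0.
have {}gu0 : 'd g 0 u = 0 by rewrite -germ_diffE.
have [V [k [kp [Vc [V0 [k0 [G _]]]]]]] := common_vertical_germ g g.
have E1 := @colim_in_fmap _ _ (germ_tangent e') _ _ (germ_of (GermRep G)) u.
apply: etrans (esym E1) _.
have -> : fmap (germ_tangent e') (germ_of (GermRep G)) u = 0.
  by rewrite /= germ_diffE.
exact: linear0.
Qed.

End Fiber.

Theorem theorem2 (R : realType) (E B : diffeologicalType R) (f : E -> B) (e : E) :
  diffeological_bundle f ->
  filtered_pointed e ->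
  filtered_pointed (f e) ->
  injective (tangent_map (smooth_val (fiber f (f e))) (fiber_point f e)).
Proof.
move=> bf filE filB; have [_ [sf _]] := bf.
apply: raddf_inj => xi.
have [p [u ->]] := fiber_class_surj sf bf filB filE xi.
move=> H; apply: (fiber_class_eq0 sf bf filB filE).
exact: etrans (esym (tangent_map_class _ _)) H.
Qed.
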